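(* Let $\mathcal{M}=(S,d)$ be any metric space and fix $\epsilon>0$. Consider the online algorithm $\mathrm{ALG}(\epsilon)$ for the Minimum-Cost Perfect Matching with Delays problem on $\mathcal{M}$. Then $\mathrm{ALG}(\epsilon)$ is $O\!\left(\frac{1}{\epsilon}\, m^{\log_2\left(\frac{3+\epsilon}{2}\right)}\right)$-competitive, where $m$ is the number of requests in the instance; that is, on every instance with $m$ requests, the cost paid by $\mathrm{ALG}(\epsilon)$ is at most $O\!\left(\frac{1}{\epsilon}\, m^{\log_2\left(\frac{3+\epsilon}{2}\right)}\right)$ times the optimal cost.
   Context: Minimum-Cost Perfect Matching with Delays (MPMD): a metric space $(S,d)$ is given. An instance is a sequence of $m$ requests ($m$ even, unknown to the algorithm in advance); each request $r$ has a location $x(r)\in S$ and an arrival time $t(r)\in\mathbb{R}$, and is revealed to the online algorithm at time $t(r)$ together with its distances to all previously revealed requests. The algorithm must produce a perfect matching of the requests in real time: two not-yet-matched requests $p,q$ may be matched at any time $t\ge\max(t(p),t(q))$, and every request must be matched after finite time. If the algorithm matches pairs $(p_i,q_i)$ at times $t_i$, $i=1,\dots,m/2$, its cost is $\sum_i \big(d(x(p_i),x(q_i)) + |t_i-t(p_i)|+|t_i-t(q_i)|\big)$. $\mathrm{OPT}$ denotes the minimum possible such cost (over all perfect matchings and all admissible matching times). An algorithm is $\alpha$-competitive if on every instance its cost is at most $\alpha\cdot\mathrm{OPT}$. Time-augmented metric: $D((l_1,t_1),(l_2,t_2)) = d(l_1,l_2)+|t_1-t_2|$ on $S\times\mathbb{R}$;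 a request $r$ is identified with the point $(x(r),t(r))$, so $D(p,q)=d(x(p),x(q))+|t(p)-t(q)|$. Algorithm $\mathrm{ALG}(\epsilon)$, $\epsilon>0$: at every moment $t$, for every ordered pair of distinct currently unmatched (already arrived) requests $p,q$ with $t(p)\ge t(q)$, if $t = t(p)+D(p,q)/\epsilon$ then $p$ and $q$ are matched at time $t$ (i.e., each request $p$ grows a hemisphere of radius $\epsilon(t-t(p))$ in the negative time direction and is matched to an earlier unmatched request as soon as it lies on that hemisphere's boundary). Ties are broken arbitrarily. $\log$ denotes $\log_2$. *)

(* Defs.v *)
From mathcomp Require Import all_boot all_order all_algebra.
From mathcomp Require Import all_classical all_reals all_analysis.

Set Implicit Arguments.
Unset Strict Implicit.
Unset Printing Implicit Defensive.

Import Order.TTheory GRing.Theory Num.Theory.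

Local Open Scope classical_set_scope.
Local Open Scope ring_scope.

Section MPMD.
Context {R : realType} {S : metricType R}.

(* Request i has location (I i).1 and arrival time (I i).2. *)
Definition instance (m : nat) := 'I_m -> S * R.

Definition taug_dist (u v : S * R) : R := mdist u.1 v.1 + `|u.2 - v.2|.

(* An item (p, q, t) says that p and q are matched with each other at time t. *)
Definition schedule (m : nat) := seq ('I_m * 'I_m * R).

Definition matched_requests m (s : schedule m) : seq 'I_m :=
  flatten [seq [:: e.1.1; e.1.2] | e <- s].

Definition matched_by m (s : schedule m) (p : 'I_m) (t : R) : bool :=
  has (fun e => (p \in [:: e.1.1; e.1.2]) && (e.2 <= t)) s.

(* Every request is matched exactly once, and not before both partners have
   arrived. *)
Definition feasible m (I : instance m) (s : schedule m) : Prop :=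
  perm_eq (matched_requests s) (enum 'I_m) /\
  forall p q t, (p, q, t) \in s -> Num.max (I p).2 (I q).2 <= t.

Definition cost m (I : instance m) (s : schedule m) : R :=
  \sum_(e <- s) (mdist (I e.1.1).1 (I e.1.2).1
                 + `|e.2 - (I e.1.1).2| + `|e.2 - (I e.1.2).2|).

(* The infimum is attained, by matching every pair of some perfect matching
   at the later of its two arrival times. For odd m there is no feasible
   schedule and the value is meaningless. *)
Definition opt m (I : instance m) : R := inf [set cost I s | s in feasible I].

(* An algorithm whose ties are broken arbitrarily is represented by the set of
   all its possible outcomes on each instance. *)
Definition algorithm := forall m : nat, instance m -> set (schedule m).

(* The competitive ratio alpha may depend on the number of requests. *)
Definition competitive (A : algorithm) (alpha : nat -> R) : Prop :=
  forall (m : nat) (I : instance m), ~~ odd m ->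
    A m I !=set0 /\
    forall s, A m I s -> feasible I s /\ cost I s <= alpha m * opt I.

(* At time t the earlier request q lies on the boundary of the hemisphere
   of p. *)
Definition triggers (eps : R) m (I : instance m) (p q : 'I_m) (t : R) : Prop :=
  (I q).2 <= (I p).2 /\ t = (I p).2 + taug_dist (I p) (I q) / eps.

(* Perfectness of the matching is not imposed. The last clause forces a match:
   two distinct requests cannot both be still unmatched once the matches of
   time t are made if their pair triggers at t. At least one of them, not
   necessarily both, being matched by then accounts for partners that were
   matched to others earlier and for arbitrary tie-breaking at time t. *)
Definition ALG (eps : R) : algorithm := fun m I s =>
  [/\ uniq (matched_requests s),
      forall p q t, (p, q, t) \in s -> triggers eps I p q t &
      forall p q t, p != q -> triggers eps I p q t ->
        matched_by s p t || matched_by s q t].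

End MPMD.

Definition log2 {R : realType} (x : R) : R := ln x / ln 2.

(* Main.v *)
(* At each step the algorithm serves the remaining pair whose trigger time
   max(t_p, t_q) + D(p,q)/eps is smallest. If p is served with q while x, in {p, q}, could have
   been served with y, then D(p,q) <= (1 + eps) D(x,y). Follow the
   Reingold-Tarjan analysis of greedy matching: whenever the algorithm removes
   the pair (p,q), the edges (p,y) and (q,z) of a competing perfect matching are
   replaced by the edge (y,z), whose length is at most
     D(p,y) + D(q,z) + (1 + eps) min(D(p,y), D(q,z)).
   With b = log2((3 + eps)/2), induction shows that an edge merging k original
   edges of total length o has length at most k^b o. Since there are m/2
   original edges, the total length of the algorithm's pairs is at most
   2 (m/2)^b = 4 m^b / (3 + eps) times that of the competing matching, and its
   cost is 1 + 2/eps times this length. *)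

Require Import Defs.
From mathcomp Require Import all_boot all_order all_algebra.
From mathcomp Require Import all_classical all_reals all_analysis.
From mathcomp Require Import ring lra.
Set Implicit Arguments.
Unset Strict Implicit.
Unset Printing Implicit Defensive.
Import Order.TTheory GRing.Theory Num.Theory.
Local Open Scope classical_set_scope.
Local Open Scope ring_scope.

(** * Reingold-Tarjan analysis of greedy matchings *)

Section GreedyMatching.
Context {R : realType} {T : eqType}.
Implicit Types (E : seq (T * T)) (F : seq (T * T * (R * R))).

Definition endpoints E : seq T := flatten [seq [:: e.1; e.2] | e <- E].

Lemma perm_endpoints E1 E2 :
  perm_eq E1 E2 -> perm_eq (endpoints E1) (endpoints E2).
Proof. by move=> E12; apply/perm_flatten/perm_map. Qed.

Lemma size_endpoints E : size (endpoints E) = (size E).*2.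
Proof. by elim: E => //= e E /= ->. Qed.

Lemma mem_endpoints E e x : e \in E -> x \in [:: e.1; e.2] -> x \in endpoints E.
Proof. by move=> eE xe; apply/flatten_mapP; exists e. Qed.

Lemma endpoints_inj E e f x : uniq (endpoints E) -> e \in E -> f \in E ->
  x \in [:: e.1; e.2] -> x \in [:: f.1; f.2] -> e = f.
Proof.
elim: E => //= g E IH /and3P[gE gE' uE].
have gN h : h \in E -> x \in [:: g.1; g.2] -> x \in [:: h.1; h.2] -> False.
  move=> hE; rewrite mem_seq2 => /orP[] /eqP -> xh.
    by move/negP: gE; apply; rewrite inE (mem_endpoints hE xh) orbT.
  by move/negP: gE'; apply; exact: mem_endpoints xh.
rewrite !(in_cons g) => /orP[/eqP -> | eE] /orP[/eqP -> | fE] // xe xf.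
- by case: (gN f fE xe xf).
- by case: (gN e eE xf xe).
- exact: IH.
Qed.

Lemma uniq_of_endpoints E : uniq (endpoints E) -> uniq E.
Proof.
elim: E => //= e E IH /and3P[eE _ uE]; rewrite IH// andbT.
apply: contra eE => eE.
by rewrite inE (mem_endpoints eE) ?orbT// mem_head.
Qed.

Lemma endpoints_pick F x : x \in endpoints [seq f.1 | f <- F] ->
  exists f F' y, perm_eq F (f :: F') /\ (f.1 = (x, y) \/ f.1 = (y, x)).
Proof.
move=> /flatten_mapP[e /mapP[f fF ->]].
rewrite !inE => /orP[] /eqP ->; exists f, (rem f F).
  by exists f.1.2; split; [exact: perm_to_rem | left]; case: (f.1).
by exists f.1.1; split; [exact: perm_to_rem | right]; case: (f.1).
Qed.

(* The hypothesis on [c] amounts to tightness at [i = j], [s1 = s2]. *)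
Lemma merge_weight (b c i j s1 s2 a : R) : 0 <= b -> 2 + c = 2 * 2 `^ b ->
  0 < i -> 0 < j -> 0 <= s1 -> 0 <= s2 ->
  a <= c * (i `^ b * s1) -> a <= c * (j `^ b * s2) ->
  i `^ b * s1 + a + j `^ b * s2 <= (i + j) `^ b * (s1 + s2).
Proof.
move=> b0 c2 i0 j0 s10 s20 a1 a2.
have X0 : 0 < i `^ b by exact: powR_gt0.
have Y0 : 0 < j `^ b by exact: powR_gt0.
have ij0 : 0 < i + j by exact: addr_gt0.
have XZ : i `^ b <= (i + j) `^ b by apply: ge0_ler_powR; rewrite ?nnegrE; lra.
have YZ : j `^ b <= (i + j) `^ b by apply: ge0_ler_powR; rewrite ?nnegrE; lra.
have t0 : 0 < 2 `^ b :> R by exact: powR_gt0.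
(* This is [4 * i * j <= (i + j)^2] raised to the power [b]. *)
have tXYZ : (2 `^ b) ^+ 2 * (i `^ b * j `^ b) <= ((i + j) `^ b) ^+ 2.
  rewrite !expr2 -!powRM ?mulr_ge0 ?(ltW i0) ?(ltW j0) ?(ltW ij0)//.
  by apply: ge0_ler_powR => //; rewrite ?nnegrE; have := sqr_ge0 (i - j); nra.
set X := i `^ b in X0 XZ a1 tXYZ *; set Y := j `^ b in Y0 YZ a2 tXYZ *.
set Z := (i + j) `^ b in XZ YZ tXYZ *; set t := 2 `^ b in c2 t0 tXYZ *.
pose P := Z / X; pose Q := Z / Y.
have ZP : Z = P * X by rewrite divfK ?gt_eqF.
have ZQ : Z = Q * Y by rewrite divfK ?gt_eqF.
have P1 : 1 <= P by rewrite ler_pdivlMr ?mul1r.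
have Q1 : 1 <= Q by rewrite ler_pdivlMr ?mul1r.
have PQt : t ^+ 2 <= P * Q.
  rewrite -(ler_pM2r (mulr_gt0 X0 Y0)) (le_trans tXYZ)//.
  by rewrite mulrACA -ZP -ZQ expr2.
(* AM-GM: [P + Q >= 2 * sqrt (P * Q) >= 2 * t = 2 + c] *)
have PQ : 2 + c <= P + Q.
  rewrite c2 -(@ler_pXn2r _ 2) ?nnegrE//; [|lra|lra].
  have := sqr_ge0 (P - Q); rewrite !expr2 in PQt *; nra.
have -> : Z * (s1 + s2) = P * (X * s1) + Q * (Y * s2).
  by rewrite mulrDr !mulrA -ZP -ZQ.
have A0 : 0 <= X * s1 by rewrite mulr_ge0// ltW.
have B0 : 0 <= Y * s2 by rewrite mulr_ge0// ltW.
move: (X * s1) (Y * s2) A0 B0 a1 a2 => A B A0 B0 a1 a2.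
(* Since [a <= c * min A B], the AM-GM bound scaled by [min A B] pays for [a] and for the common
   part of [A] and [B]; the excess of the larger one is covered by [Q >= 1] or [P >= 1]. *)
have cAB : (2 + c) * Num.min A B <= (P + Q) * Num.min A B.
  by rewrite ler_wpM2r// le_min A0.
move: cAB; have [AB|BA] := leP A B => cAB.
  have QAB : 0 <= (Q - 1) * (B - A) by rewrite mulr_ge0 ?subr_ge0.
  by nra.
have PAB : 0 <= (P - 1) * (A - B) by rewrite mulr_ge0 ?subr_ge0 ?(ltW BA).
by nra.
Qed.

Variables (D : T -> T -> R) (b c : R).
Hypotheses (b_ge0 : 0 <= b) (c_def : 2 + c = 2 * 2 `^ b).
Hypotheses (D_sym : forall x y, D x y = D y x)
  (D_triangle : forall y x z, D x z <= D x y + D y z).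

(* In an edge [(x, y, (k, o))] of the competing matching, [k] is the number of
   original edges merged into it and [o] their total length. *)
Definition weight (f : T * T * (R * R)) : R := f.2.1 `^ b * f.2.2.

Definition valid_edge (f : T * T * (R * R)) : bool :=
  [&& 0 < f.2.1, 0 <= f.2.2 & D f.1.1 f.1.2 <= weight f].

(** All that the analysis retains of the algorithm; it is applied with [c = 1 + eps]. *)
Definition greedy_before (e f : T * T) : bool :=
  allrel (fun x y => D e.1 e.2 <= c * D x y) [:: e.1; e.2] [:: f.1; f.2].

(* [E] lists the greedy pairs in order of removal. A merge raises the
   total weight by at least the length of the removed pair; a pair that closes a
   cycle is paid for by the weight of the edge it coincides with. *)
Lemma greedy_matching_bound (K : R) E F : pairwise greedy_before E ->
  perm_eq (endpoints E) (endpoints [seq f.1 | f <- F]) ->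
  all valid_edge F -> \sum_(f <- F) f.2.1 <= K ->
  \sum_(e <- E) D e.1 e.2 + \sum_(f <- F) weight f
    <= 2 * (K `^ b * \sum_(f <- F) f.2.2).
Proof.
have split1 F1 x y f F' : perm_eq F1 (f :: F') ->
    f.1 = (x, y) \/ f.1 = (y, x) ->
    perm_eq (endpoints [seq g.1 | g <- F1])
            (x :: y :: endpoints [seq g.1 | g <- F']).
  move=> FF' fE; apply: perm_trans (perm_endpoints (perm_map _ FF')) _ => /=.
  by case: fE => -> //=; apply/permP => P /=; rewrite addnCA.
have Dval f x y : valid_edge f -> f.1 = (x, y) \/ f.1 = (y, x) ->
    [/\ 0 < f.2.1, 0 <= f.2.2 & D x y <= weight f].
  by move=> /and3P[? ? Df] []fE; split=> //; move: Df; rewrite fE //= D_sym.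
elim: E F => [|[p q] E IH] F.
  move=> _ /perm_size; rewrite !size_endpoints size_map.
  by case: F => // _ _ _; rewrite !big_nil mulr0 mulr0 addr0.
rewrite pairwise_cons => /andP[/allP gE pE] pF.
have : p \in endpoints [seq f.1 | f <- F].
  by rewrite -(perm_mem pF) inE eqxx.
move=> /endpoints_pick[f [F1 [y [FF1 fE]]]].
have {}pF : perm_eq (q :: endpoints E) (y :: endpoints [seq g.1 | g <- F1]).
  by rewrite -(perm_cons p) (perm_trans pF)// (split1 _ _ _ _ _ FF1 fE).
rewrite (perm_all _ FF1) /= => /andP[vf vF1].
rewrite !(perm_big _ FF1) /= !big_cons /=.
have [k0 o0 Df] := Dval _ _ _ vf fE.
have K0 F' : all valid_edge F' -> 0 <= \sum_(g <- F') g.2.1.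
  by move=> /allP vF'; rewrite big_seq sumr_ge0// => g /vF' /and3P[/ltW].
have far x : x \in endpoints E -> D p q <= c * D p x /\ D p q <= c * D q x.
  move=> /flatten_mapP[g /gE /allrelP gx xg].
  by split; apply: gx => //; rewrite !inE eqxx ?orbT.
(* If [y = q], the edge [f] is dropped: [D p q] and [weight f] are each at most [K^b] times the
   original length in [f], which is where the factor 2 is spent. *)
have [yq|yq] := eqVneq y q.
  move: pF Df; rewrite yq perm_cons => pF Df kK.
  have kf : f.2.1 <= K by have := K0 _ vF1; lra.
  have IH1 := IH F1 pE pF vF1.
  have wf : weight f <= K `^ b * f.2.2.
    by rewrite ler_wpM2r// ge0_ler_powR// nnegrE; lra.
  have := IH1 _; lra.
have yE : y \in endpoints E.
  have : y \in q :: endpoints E by rewrite (perm_mem pF) inE eqxx.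
  by rewrite inE (negbTE yq).
have : q \in endpoints [seq f.1 | f <- F1].
  have : q \in y :: endpoints [seq f.1 | f <- F1].
    by rewrite -(perm_mem pF) inE eqxx.
  by rewrite inE eq_sym (negbTE yq).
move=> /endpoints_pick[g [F2 [z [FF2 fG]]]].
have {}pF : perm_eq (endpoints E) (y :: z :: endpoints [seq g.1 | g <- F2]).
  rewrite -(perm_cons q) (perm_trans pF)//.
  have := split1 _ _ _ _ _ FF2 fG; rewrite -(perm_cons y) => /permPl ->.
  by apply/permP => P /=; rewrite addnCA.
move: vF1; rewrite (perm_all _ FF2) /= => /andP[vg vF2].
rewrite !(perm_big _ FF2) /= !big_cons /= => kK.
have [k0' o0' Dg] := Dval _ _ _ vg fG.
have zE : z \in endpoints E by rewrite (perm_mem pF) !inE eqxx orbT.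
have [far1 _] := far _ yE; have [_ far2] := far _ zE.
have c0 : 0 <= c.
  have : 2 `^ 0 <= 2 `^ b :> R by apply: ler_powR; rewrite ?ler1n.
  by rewrite powRr0 => t1; have := c_def; lra.
pose h : T * T * (R * R) := ((y, z), (f.2.1 + g.2.1, f.2.2 + g.2.2)).
have hw : weight f + D p q + weight g <= weight h.
  apply: (merge_weight b_ge0 c_def) => //.
    by apply: le_trans far1 _; rewrite ler_wpM2l.
  by apply: le_trans far2 _; rewrite ler_wpM2l.
(* The left side of [hw] also bounds the length of the path from [y] through [p] and [q] to [z]. *)
have vh : valid_edge h.
  rewrite /valid_edge /= addr_gt0// addr_ge0//=; apply: le_trans hw.
  have := D_triangle p y z; have := D_triangle q p z; rewrite (D_sym y p); lra.
have := IH (h :: F2) pE pF; rewrite /= vh vF2 !big_cons /= => /(_ isT).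
have := K0 _ vF2; lra.
Qed.

End GreedyMatching.

(** * Time-augmented metric, trigger times and existence of an outcome *)

Section Schedules.
Context {R : realType} {S : metricType R}.

Lemma taug_dist_sym (u v : S * R) : taug_dist u v = taug_dist v u.
Proof. by rewrite /taug_dist metric_sym distrC. Qed.

Lemma taug_dist_triangle (v u w : S * R) :
  taug_dist u w <= taug_dist u v + taug_dist v w.
Proof.
rewrite /taug_dist addrACA lerD ?metric_triangle//.
by rewrite (le_trans _ (ler_normD _ _))// subrKA.
Qed.

Lemma taug_dist_ge0 (u v : S * R) : 0 <= taug_dist u v.
Proof. by rewrite addr_ge0 ?mdist_ge0. Qed.

Variables (m : nat) (I : @instance R S m).
Implicit Types (s : @schedule R m) (p q x y : 'I_m).

Local Notation D x y := (taug_dist (I x) (I y)).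

Lemma matched_requestsE s :
  matched_requests s = endpoints [seq e.1 | e <- s].
Proof. by rewrite /endpoints -map_comp. Qed.

Lemma matched_byP s p t :
  reflect (exists2 e, e \in s & p \in [:: e.1.1; e.1.2] /\ e.2 <= t)
          (matched_by s p t).
Proof.
apply: (iffP hasP) => -[e es]; first by move=> /andP[]; exists e.
by move=> [pe et]; exists e => //; rewrite pe.
Qed.

Lemma matched_by_mem s p t : matched_by s p t -> p \in matched_requests s.
Proof. by move=> /matched_byP[e es [pe _]]; apply/flatten_mapP; exists e. Qed.

Lemma cost_ge_dist s : \sum_(e <- s) D e.1.1 e.1.2 <= cost I s.
Proof.
rewrite /cost ler_sum// => -[[p q] t] _ /=.
rewrite /taug_dist -addrA lerD2l (distrC t (I p).2).
by apply: le_trans (ler_normD _ _); rewrite subrKA.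
Qed.

Variables (eps : R) (eps_gt0 : 0 < eps).

(** The maximum makes this symmetric, so that one formula serves both orders of arrival. *)
Definition trigger_time x y : R := Num.max (I x).2 (I y).2 + D x y / eps.

Lemma triggers_time p q t : triggers eps I p q t -> t = trigger_time p q.
Proof. by move=> [qp ->]; rewrite /trigger_time max_l. Qed.

Lemma triggers_or x y : triggers eps I x y (trigger_time x y) \/
                        triggers eps I y x (trigger_time x y).
Proof.
rewrite /trigger_time /triggers; have [xy|/ltW yx] := leP (I x).2 (I y).2.
  by right; rewrite taug_dist_sym.
by left.
Qed.

(** Repeatedly matching the remaining pair with the smallest trigger time gives an outcome; the
    induction runs over the set [U] of remaining requests. *)
Lemma ALG_exists : ALG eps I !=set0.
Proof.
suff H n (U : {set 'I_m}) : (#|U| <= n)%N -> exists s : @schedule R m,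
    [/\ uniq (matched_requests s), {subset matched_requests s <= U},
        forall p q t, (p, q, t) \in s -> triggers eps I p q t &
        forall p q t, p \in U -> q \in U -> p != q -> triggers eps I p q t ->
          matched_by s p t || matched_by s q t].
  have [s [us _ st sm]] := H _ [set: 'I_m]%SET (leqnn _).
  by exists s; split=> // p q t; apply: sm; rewrite inE.
elim: n U => [|n IH] U Un.
  exists [::]; split=> // p q t; move: Un; rewrite leqn0 cards_eq0 => /eqP ->.
  by rewrite inE.
pose P (e : 'I_m * 'I_m) := [&& e.1 \in U, e.2 \in U & e.1 != e.2].
have [[e0 Pe0]|noP] := pselect (exists e, P e); last first.
  exists [::]; split=> // p q t pU qU pq; case: noP.
  by exists (p, q); rewrite /P pU qU.
pose tau (e : 'I_m * 'I_m) := trigger_time e.1 e.2.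
case: (@Order.TotalTheory.arg_minP _ _ _ e0 P tau Pe0) => -[a b].
move=> /and3P[/= aU bU ab] tmin.
wlog trig : a b aU bU ab tmin / triggers eps I a b (trigger_time a b).
  move=> wl; have [|trig] := triggers_or a b; first exact: wl.
  apply: (wl b a) => //; first by rewrite eq_sym.
    by move=> e /tmin; rewrite /tau /trigger_time /= taug_dist_sym maxC.
  by rewrite -(triggers_time trig).
have UU : (#|U :\ a :\ b| <= n)%N.
  rewrite -ltnS (leq_trans _ Un)// (cardsD1 a U) aU add1n ltnS subset_leq_card//.
  exact: subsetDl.
have [s [us sU st sm]] := IH _ UU.
exists ((a, b, trigger_time a b) :: s); split.
- rewrite /= us inE negb_or ab andbT /=; apply/andP; split.
    by apply/negP => /sU; rewrite !inE eqxx andbF.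
  by apply/negP => /sU; rewrite !inE eqxx.
- move=> x; rewrite /= !inE => /or3P[/eqP ->|/eqP ->|/sU]//.
  by rewrite !inE => /and3P[].
- by move=> p q t; rewrite inE => /orP[/eqP[-> -> ->]|/st].
- move=> p q t pU qU pq trig'.
  (* By minimality, a triggering pair that contains [a] or [b] finds that request already matched;
     every other pair is left to the induction. *)
  have tt : trigger_time a b <= t.
    by rewrite (triggers_time trig'); apply: (tmin (p, q)); rewrite /P pU qU.
  rewrite /= tt !andbT !inE -!/(matched_by _ _ _).
  have [//|pa] := eqVneq p a; have [//|pb] := eqVneq p b => /=.
  have [|qa] := eqVneq q a; first by rewrite /= orbT.
  have [|qb] := eqVneq q b; first by rewrite /= orbT.
  by apply: sm => //; rewrite !inE ?pa ?pb ?qa ?qb.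
Qed.

(** * Feasibility, cost and greediness of any outcome *)

Section Outcome.
Variable s : @schedule R m.
Hypothesis ALGs : ALG eps I s.

Let uniq_s : uniq (matched_requests s). Proof. by case: ALGs. Qed.
Let trig_s p q t : (p, q, t) \in s -> triggers eps I p q t.
Proof. by case: ALGs => _ + _; apply. Qed.
Let match_s x y : x != y ->
  matched_by s x (trigger_time x y) || matched_by s y (trigger_time x y).
Proof.
case: ALGs => _ _ sm xy; have [/sm ->//|/sm] := triggers_or x y.
by rewrite orbC eq_sym => ->.
Qed.

(** By parity an unmatched request leaves a second one, but this pair triggers at a finite time,
    when one of the two must be matched. *)
Lemma ALG_feasible : ~~ odd m -> feasible I s.
Proof.
move=> om; split; last first.
  move=> p q t /trig_s[qp ->]; rewrite max_l// lerDl.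
  by rewrite divr_ge0 ?taug_dist_ge0// ltW.
apply: uniq_perm; rewrite ?enum_uniq// => x; rewrite mem_enum inE.
apply/negPn/negP => xs.
have oU : ~~ odd #|[predC matched_requests s]|.
  have := cardC (mem (matched_requests s)); rewrite card_ord => cm.
  have := congr1 odd cm; rewrite oddD (card_uniqP uniq_s) matched_requestsE.
  by rewrite size_endpoints odd_double -matched_requestsE /= => ->.
have : (1 < #|[predC matched_requests s]|)%N.
  have : (0 < #|[predC matched_requests s]|)%N by apply/card_gt0P; exists x.
  by move: oU; case: #|_| => [|[]].
move=> /card_gt1P[y [z [/= yU zU yz]]].
have /orP[/matched_by_mem|/matched_by_mem] := match_s yz.
  by apply/negP.
by apply/negP.
Qed.

(** The later request waits [D / eps]; the earlier one waits in addition the arrival gap, which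
    together with the distance makes up [D]. *)
Lemma ALG_cost : cost I s = (1 + 2 / eps) * \sum_(e <- s) D e.1.1 e.1.2.
Proof.
rewrite mulr_sumr /cost !big_seq; apply: eq_bigr => -[[p q] t] /trig_s /=.
move=> [qp ->].
have Dpq : 0 <= D p q / eps by rewrite divr_ge0 ?taug_dist_ge0// ltW.
have DE : D p q = mdist (I p).1 (I q).1 + ((I p).2 - (I q).2).
  by rewrite /taug_dist ger0_norm ?subr_ge0.
move: (D p q) Dpq DE => d d0 dE.
rewrite (addrAC (I p).2) subrr add0r ger0_norm// ger0_norm; last by lra.
by rewrite mulrDl mul1r {3}dE; ring.
Qed.

(* [e] is served before [x] and [y] trigger, and the later arrival of [e] is not
   before that of [x], so comparing the two trigger times loses at most the
   delay between [x] and [y], which is at most [D x y]. *)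
Lemma ALG_greedy e f x y : e \in s -> f \in s -> e.1 != f.1 -> e.2 <= f.2 ->
  x \in [:: e.1.1; e.1.2] -> y \in [:: f.1.1; f.1.2] ->
  D e.1.1 e.1.2 <= (1 + eps) * D x y.
Proof.
move=> es fs ef tef xe yf.
have us : uniq (endpoints [seq g.1 | g <- s]) by rewrite -matched_requestsE.
have same g h z : g \in s -> h \in s ->
    z \in [:: g.1.1; g.1.2] -> z \in [:: h.1.1; h.1.2] -> g.1 = h.1.
  by move=> gs hs zg zh; apply: (endpoints_inj us _ _ zg zh); apply: map_f.
have timeE g : g \in s -> g.2 = trigger_time g.1.1 g.1.2.
  by case: g => -[p q] t /trig_s /triggers_time.
have xy : x != y.
  by apply: contra ef => /eqP xyE; rewrite (same e f x) ?xyE// -xyE.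
(* Whichever of [x] and [y] is matched by then, its match is [e] or [f], and [f] is not earlier than
   [e]. *)
have exy : e.2 <= trigger_time x y.
  have /orP[] := match_s xy => /matched_byP[g gs [zg]].
    by rewrite !timeE// (same _ _ _ gs es zg xe).
  apply: le_trans; rewrite (le_trans tef)// !timeE//.
  by rewrite (same _ _ _ gs fs zg yf).
have xe' : (I x).2 <= Num.max (I e.1.1).2 (I e.1.2).2.
  by move: xe; rewrite mem_seq2 le_max => /orP[] /eqP ->; rewrite lexx ?orbT.
have xyD : Num.max (I x).2 (I y).2 <= (I x).2 + D x y.
  rewrite ge_max lerDl taug_dist_ge0 -lerBlDl /taug_dist distrC.
  by rewrite (le_trans (ler_norm _))// lerDr mdist_ge0.
move: exy; rewrite timeE// /trigger_time => exy.
move: (D e.1.1 e.1.2) (D x y) exy xyD => d d' exy xyD.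
have : d / eps <= d' + d' / eps by lra.
by rewrite ler_pdivrMr// mulrDl divfK ?gt_eqF//; lra.
Qed.

Lemma ALG_sum (s' : @schedule R m) : ~~ odd m -> feasible I s' ->
  (3 + eps) * \sum_(e <- s) D e.1.1 e.1.2 <=
  4 * (m%:R `^ log2 ((3 + eps) / 2) * \sum_(e <- s') D e.1.1 e.1.2).
Proof.
move=> om [ps' _]; have e0 := eps_gt0.
set b := log2 _.
have b0 : 0 <= b by rewrite /b /log2 divr_ge0 ?ln_ge0 ?ler1n//; lra.
have c2 : 2 + (1 + eps) = 2 * 2 `^ b.
  have l2 : ln 2 != 0 :> R by rewrite gt_eqF// ln_gt0// ltr1n.
  rewrite /powR gt_eqF// /b /log2 divfK// lnK ?posrE; first by field.
  by lra.
(* The order of removal is that of the matching times. *)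
pose r := sort (fun e f : 'I_m * 'I_m * R => e.2 <= f.2) s.
have rs : perm_eq r s by rewrite perm_sort.
have us : uniq (endpoints [seq e.1 | e <- s]) by rewrite -matched_requestsE.
(* Each competing edge starts as a single original edge, so the counts sum to [m / 2]. *)
pose F : seq ('I_m * 'I_m * (R * R)) :=
  [seq (e.1, (1, D e.1.1 e.1.2)) | e <- s'].
have FE : [seq f.1 | f <- F] = [seq e.1 | e <- s'] by rewrite -map_comp.
have sz : (size s')%:R = m%:R / 2 :> R.
  have := perm_size ps'; rewrite matched_requestsE size_endpoints size_map.
  rewrite size_enum_ord => /(congr1 (fun n => n%:R : R)) <-.
  by rewrite -muln2 natrM mulfK.
have mE : m%:R `^ b = (3 + eps) / 2 * (m%:R / 2) `^ b.
  have -> : (3 + eps) / 2 = 2 `^ b by lra.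
  by rewrite -powRM// mulrC divfK.
have := @greedy_matching_bound R _ (fun x y => D x y) b (1 + eps)
  b0 c2 (fun x y => taug_dist_sym (I x) (I y))
  (fun y x z => taug_dist_triangle (I y) (I x) (I z)) (m%:R / 2)
  [seq e.1 | e <- r] F.
rewrite !big_map (perm_big _ rs) /= FE => H.
rewrite mE; set X := \sum_(e <- s) _; set Y := \sum_(e <- s') _.
suff : X <= 2 * ((m%:R / 2) `^ b * Y).
  rewrite -(@ler_pM2l _ (3 + eps)); last by lra.
  by move/le_trans; apply; rewrite le_eqVlt; apply/orP; left; apply/eqP; field.
apply: le_trans (H _ _ _ _).
- by rewrite lerDl sumr_ge0// => e _; rewrite /weight mulr_ge0 ?powR_ge0 ?taug_dist_ge0.
- rewrite pairwise_map.
  have : pairwise [rel e f : 'I_m * 'I_m * R | (e.2 <= f.2) && (e.1 != f.1)] r.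
    rewrite pairwise_relI; apply/andP; split.
      have le_tr : transitive (fun e f : 'I_m * 'I_m * R => e.2 <= f.2).
        by move=> f e g; exact: le_trans.
      rewrite -(sorted_pairwise le_tr) sort_sorted// => e f; exact: le_total.
    have : uniq [seq e.1 | e <- r].
      by rewrite (perm_uniq (perm_map _ rs)) uniq_of_endpoints.
    by rewrite uniq_pairwise pairwise_map.
  apply: (@sub_in_pairwise _ (mem s)); last by rewrite (perm_all _ rs); apply/allP.
  move=> e f es fs /andP[tef ef]; apply/allrelP => x y; exact: ALG_greedy.
- apply: perm_trans (perm_endpoints (perm_map _ rs)) _.
  have [ps _] := ALG_feasible om.
  by rewrite -!matched_requestsE (perm_trans ps)// perm_sym.
- apply/allP => _ /mapP[e _ ->]; rewrite /valid_edge /weight /= taug_dist_ge0 ltr01.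
  by rewrite powR1 mul1r lexx.
- by rewrite big_const_seq count_predT iter_addr_0 sz.
Qed.

End Outcome.
End Schedules.

(** * Comparison with the optimum *)

Theorem theorem2 (R : realType) :
  exists2 C : R, 0 < C &
    forall (S : metricType R) (eps : R), 0 < eps ->
      competitive (@ALG R S eps)
        (fun m => C * (eps^-1 * m%:R `^ log2 ((3 + eps) / 2))).
Proof.
(* The ratio is [(1 + 2/eps) * 4 m^b / (3 + eps)], and [2 + eps <= 3 + eps]. *)
exists 4 => // S eps eps0 m I om; split; first exact: ALG_exists.
move=> s ALGs; split; first exact: ALG_feasible ALGs om.
(* For [m = 0] the cost and the ratio both vanish; otherwise the ratio is positive and can be
   divided out to reach the infimum. *)
have [m0|m0] := posnP m.
  subst m; rewrite (ALG_cost eps0 ALGs).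
  case: s ALGs => [_|[[[//]]]]; rewrite big_nil mulr0 powR0 ?mulr0 ?mul0r//.
  by rewrite gt_eqF// divr_gt0 ?ln_gt0 ?ltr1n//; lra.
set b := log2 _.
have K0 : 0 < m%:R `^ b by rewrite powR_gt0 ?ltr0n.
have a0 : 0 < 4 * (eps^-1 * m%:R `^ b) by rewrite !mulr_gt0 ?invr_gt0.
rewrite -ler_pdivrMl// lb_le_inf//.
  by exists (cost I s), s => //; exact: ALG_feasible ALGs om.
move=> _ [s' fs' <-]; rewrite ler_pdivrMl// (ALG_cost eps0 ALGs)//.
have sum0 : 0 <= \sum_(e <- s) taug_dist (I e.1.1) (I e.1.2).
  by rewrite sumr_ge0// => e _; exact: taug_dist_ge0.
have := ALG_sum eps0 ALGs om fs'; have := cost_ge_dist I s'.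
rewrite -/b; move: (\sum_(e <- s) _) (\sum_(e <- s') _) sum0 => X Y X0 Ys' XY.
have -> : 1 + 2 / eps = eps^-1 * (2 + eps) by field; rewrite gt_eqF.
rewrite [4 * _]mulrCA -!(mulrA eps^-1) ler_pM2l ?invr_gt0//.
have := ler_wpM2l (ltW K0) Ys'; lra.
Qed.
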